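(* Let $E: y^2 = x^3+ax^2+bx+c$ with $a,b,c\in\mathbb{Z}$ be an elliptic curve and let $P\in E(\mathbb{Q})$ be a point of infinite order. For all integers $k\neq \ell$ with $k,\ell\ge 0$, we have $\gcd(F_k(E,P),F_\ell(E,P))\in\{1,2\}$.
   Context: An elliptic curve here is a non-singular cubic $y^2=x^3+ax^2+bx+c$ with $a,b,c\in\mathbb{Z}$. For $k\ge 0$ write $2^kP=\left(\frac{m_k}{e_k^2},\frac{n_k}{e_k^3}\right)$ with $m_k,n_k,e_k\in\mathbb{Z}$, $e_k\ge 1$, $\gcd(m_k,e_k)=\gcd(n_k,e_k)=1$, where $2^kP$ is $P$ added to itself $2^k$ times under the group law. The elliptic Fermat numbers are $F_0(E,P)=e_0$ and $F_k(E,P)=e_k/e_{k-1}$ for $k\ge1$. *)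

(* Defs.v *)
From mathcomp Require Import all_boot all_order all_algebra all_field.
From mathcomp Require Import ring.

Set Implicit Arguments.
Unset Strict Implicit.
Unset Printing Implicit Defensive.

Import Order.TTheory GRing.Theory Num.Theory.
Local Open Scope ring_scope.

Definition on_cubic (K : fieldType) (a b c : int) (x y : K) : Prop :=
  y ^+ 2 = x ^+ 3 + a%:~R * x ^+ 2 + b%:~R * x + c%:~R.

(* A singular point of the affine curve: both partial derivatives of
   y^2 - (x^3 + a x^2 + b x + c) vanish there. The point at infinity of the
   projective closure is never singular. *)
Definition singular_at (K : fieldType) (a b c : int) (x y : K) : Prop :=
  [/\ on_cubic a b c x y,
      3%:R * x ^+ 2 + 2%:R * a%:~R * x + b%:~R = 0
    & 2%:R * y = 0].

(* Non-singularity is geometric, hence tested over an algebraically closed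
   field containing rat. *)
Definition is_elliptic_curve (a b c : int) : Prop :=
  forall x y : algC, ~ singular_at a b c x y.

Inductive point : Type := Infinity | Affine of rat & rat.

Definition on_curve (a b c : int) (P : point) : Prop :=
  if P is Affine x y then on_cubic a b c x y else True.

Definition third_point (a : int) (lambda x1 y1 x2 : rat) : point :=
  let x3 := lambda ^+ 2 - a%:~R - x1 - x2 in
  Affine x3 (lambda * (x1 - x3) - y1).

(* Chord-and-tangent law. For points of the curve with x1 = x2 one has
   y1 = y2 or y1 = - y2, so the tangent case is P = Q with y1 != 0. *)
Definition ec_add (a b : int) (P Q : point) : point :=
  match P, Q with
  | Infinity, _ => Q
  | _, Infinity => P
  | Affine x1 y1, Affine x2 y2 =>
      if x1 == x2 then
        if y1 == - y2 then Infinity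
        else third_point a
               ((3%:R * x1 ^+ 2 + 2%:R * a%:~R * x1 + b%:~R) / (2%:R * y1))
               x1 y1 x2
      else third_point a ((y2 - y1) / (x2 - x1)) x1 y1 x2
  end.

Definition ec_mul (a b : int) (n : nat) (P : point) : point :=
  iter n (ec_add a b P) Infinity.

Definition infinite_order (a b : int) (P : point) : Prop :=
  forall n : nat, (0 < n)%N -> ec_mul a b n P <> Infinity.

Definition lowest_terms (P : point) (m n e : int) : Prop :=
  [/\ P = Affine (m%:~R / e%:~R ^+ 2) (n%:~R / e%:~R ^+ 3),
      1 <= e, coprimez m e & coprimez n e].

(* Rational-valued, since integrality of the quotient is not part of the
   definition. *)
Definition ec_fermat (e : nat -> int) (k : nat) : rat :=
  if k is j.+1 then (e j.+1)%:~R / (e j)%:~R else (e 0%N)%:~R.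

Lemma lowest_terms_exists (a b c : int) (x y : rat) :
  on_cubic a b c x y -> exists m n e : int, lowest_terms (Affine x y) m n e.
Proof.
rewrite /on_cubic => Hc.
have cx : coprimez (numq x) (denq x) by exact: coprime_num_den.
have cy : coprimez (numq y) (denq y) by exact: coprime_num_den.
move: (denq_neq0 x) (denq_neq0 y) (denq_gt0 x) (denq_gt0 y) cx cy.
move: (divq_num_den x) (divq_num_den y).
move: (numq x) (denq x) (numq y) (denq y) => p q r s Ex Ey q0 s0 qp sp cx cy.
have q0' : q%:~R != 0 :> rat by rewrite intr_eq0.
have s0' : s%:~R != 0 :> rat by rewrite intr_eq0.
have H : s ^+ 2 * (p ^+ 3 + q * (a * p ^+ 2 + b * p * q + c * q ^+ 2))
    = r ^+ 2 * q ^+ 3.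
  apply/eqP; rewrite -(eqr_int rat) !(rmorphM, rmorphD, rmorphXn) /=.
  have -> : r%:~R = y * s%:~R by rewrite -Ey divfK.
  have -> : p%:~R = x * q%:~R by rewrite -Ex divfK.
  by rewrite [(y * _) ^+ 2]exprMn Hc; apply/eqP; ring.
have d1 : (s ^+ 2 %| q ^+ 3)%Z.
  rewrite -(@Gauss_dvdzr _ (r ^+ 2)); last first.
    by rewrite coprimezXl // coprimezXr // coprimez_sym.
  by rewrite -H dvdz_mulr.
have d2 : (q ^+ 3 %| s ^+ 2)%Z.
  rewrite -(@Gauss_dvdzl _ _
    (p ^+ 3 + q * (a * p ^+ 2 + b * p * q + c * q ^+ 2))); last first.
    rewrite coprimezXl // /coprimez addrC mulrC gcdzMDl -/(coprimez _ _).
    by rewrite coprimezXr // coprimez_sym.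
  by rewrite H dvdz_mull.
have E : q ^+ 3 = s ^+ 2.
  move: d1 d2; rewrite !dvdzE => d1 d2.
  have : `|q ^+ 3|%N = `|s ^+ 2|%N by apply/eqP; rewrite eqn_dvd d1 d2.
  by move/(congr1 Posz); rewrite !abszE !gtr0_norm ?exprn_gt0.
have /dvdzP[e se] : (q %| s)%Z.
  rewrite dvdzE -(@dvdn_pexp2r _ _ 2) // -!abszX -dvdzE -E.
  by rewrite [q ^+ 3]exprS dvdz_mull.
have qe : q = e ^+ 2.
  apply: (@mulIf _ (q ^+ 2)); first by rewrite expf_neq0.
  by rewrite -exprS E se exprMn.
have e0 : 0 < e by move: sp; rewrite se pmulr_lgt0.
exists p, r, e; rewrite /lowest_terms; split=> //.
- by rewrite -Ex -Ey -!rmorphXn /= -qe se qe -exprS.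
- by move: cx; rewrite qe coprimez_pexpr.
- by move: cy; rewrite se qe -exprS coprimez_pexpr.
Qed.

Lemma ec_add_on_curve (a b c : int) (P Q : point) :
  on_curve a b c P -> on_curve a b c Q -> on_curve a b c (ec_add a b P Q).
Proof.
case: P Q => [|x1 y1] [|x2 y2] //=; rewrite /on_cubic => h1 h2.
case: eqP => [e|/eqP ne]; [case: eqP => [//|/eqP ny] /=|] => /=.
  subst x2.
  have : (y1 - y2) * (y1 + y2) = 0 by rewrite -subr_sqr h1 h2 subrr.
  move/eqP; rewrite mulf_eq0 subr_eq0 addr_eq0 (negPf ny) orbF => /eqP e.
  subst y2; have y0 : y1 != 0.
    by apply: contra ny => /eqP ->; rewrite oppr0.
  have cE : c%:~R = y1 ^+ 2 - (x1 ^+ 3 + a%:~R * x1 ^+ 2 + b%:~R * x1) :> rat.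
    by rewrite h1; ring.
  by rewrite /on_cubic cE; field.
have d0 : x2 - x1 != 0 by rewrite subr_eq0 eq_sym.
have bE : b%:~R = (y2 ^+ 2 - y1 ^+ 2
    - (x2 ^+ 3 + a%:~R * x2 ^+ 2 - x1 ^+ 3 - a%:~R * x1 ^+ 2)) / (x2 - x1) :> rat.
  by rewrite h1 h2; field.
have cE : c%:~R = y1 ^+ 2 - (x1 ^+ 3 + a%:~R * x1 ^+ 2 + b%:~R * x1) :> rat.
  by rewrite h1; ring.
by rewrite /on_cubic cE bE; field.
Qed.

Lemma ec_lowest_terms_exists (a b c : int) (P : point) (k : nat) :
  on_curve a b c P -> infinite_order a b P ->
  exists m n e : int, lowest_terms (ec_mul a b (2 ^ k) P) m n e.
Proof.
move=> hP /(_ (2 ^ k)%N); rewrite expn_gt0 => /(_ isT).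
have : on_curve a b c (ec_mul a b (2 ^ k) P).
  by elim: (2 ^ k)%N => [|i IH] //; exact: ec_add_on_curve.
by case: ec_mul => // x y /= /lowest_terms_exists.
Qed.

(* Main.v *)
Require Import Defs.
From mathcomp Require Import all_boot all_order all_algebra all_field.
From mathcomp Require Import ring.

Import Order.TTheory GRing.Theory Num.Theory.
Local Open Scope ring_scope.

(** The duplication formula gives x(2Q) = M / (4 n^2 e^2) for Q = (m/e^2, n/e^3),
with M prime to e. Hence e_i divides e_(i+1), and F_(i+1) = e_(i+1) / e_i
divides 2 n_i, where n_i is prime to e_i. For j <= i, F_j divides e_i, so
gcd(F_j, F_(i+1)) divides 2.

To identify 2^(i+1) P with the double of 2^i P one needs associativity of the
chord-and-tangent law. When no sum involved is the point at infinity, let s and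
t be the slopes used in forming A + B and (A + B) + C; then w = s + t satisfies
w * (slope(B, C) - slope(A, B)) = x(C) - x(A). The corresponding sum for
A + (B + C) satisfies the same equation, and w determines the total sum. *)

(** * Slopes of chords and tangents over a field *)

Section Slope.
Context {K : fieldType} {a b : K}.

(* The second equation makes sense of the slope at a double point: on the
   curve it follows from the first when [x1 != x2], and for [x1 = x2], [y1 = y2]
   it is the tangent condition. *)
Definition slope (x1 y1 x2 y2 s : K) : Prop :=
  y2 - y1 = s * (x2 - x1) /\
  s * (y1 + y2) = x1 ^+ 2 + x1 * x2 + x2 ^+ 2 + a * (x1 + x2) + b.

Definition third_x (s x1 x2 : K) : K := s ^+ 2 - a - x1 - x2.
Definition third_y (s x1 y1 x2 : K) : K := s * (x1 - third_x s x1 x2) - y1.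

Lemma slope_sym {x1 y1 x2 y2 s} :
  slope x1 y1 x2 y2 s -> slope x2 y2 x1 y1 s.
Proof.
move=> [h1 h2]; split; first by rewrite -opprB h1; ring.
by rewrite addrC h2; ring.
Qed.

Lemma slope_uniq {x1 y1 x2 y2 s t} :
  ~ (x1 = x2 /\ y1 = - y2) ->
  slope x1 y1 x2 y2 s -> slope x1 y1 x2 y2 t -> s = t.
Proof.
move=> ne [h1 h2] [k1 k2].
case: (eqVneq x1 x2) => [e|ne'].
  apply: (@mulIf _ (y1 + y2)); last by rewrite h2 k2.
  by apply/eqP => /eqP; rewrite addr_eq0 => /eqP e'; apply: ne.
by apply: (@mulIf _ (x2 - x1)); rewrite ?subr_eq0 1?eq_sym // -h1 -k1.
Qed.

(** The line through A and B meets the cubic again at -(A + B), so it is also the line through B and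
    -(A + B). *)
Lemma slope_third_neg {x1 y1 x2 y2 s} :
  slope x1 y1 x2 y2 s ->
  slope x2 y2 (third_x s x1 x2) (- third_y s x1 y1 x2) s.
Proof.
move=> [h1 h2]; have e2 : y2 = y1 + s * (x2 - x1) by rewrite -h1; ring.
have eb : b = s * (y1 + y2)
    - (x1 ^+ 2 + x1 * x2 + x2 ^+ 2 + a * (x1 + x2)) by rewrite h2; ring.
by split; rewrite ?eb e2 /third_y /third_x; ring.
Qed.

(* With C = (x3, y3), the function (l1 * l2) / (x - x(A + B)), for l1, l2 the
   lines through A, B and through A + B, C, has the form x^2 + u x + v - w y
   with w = s + t; it vanishes at A, B and C, which determines w. *)
Lemma slope_add {x1 y1 x2 y2 x3 y3 s t} :
  slope x1 y1 x2 y2 s ->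
  slope (third_x s x1 x2) (third_y s x1 y1 x2) x3 y3 t ->
  (s + t) * (y3 - (s * (x3 - x1) + y1)) = (x3 - x1) * (x3 - x2).
Proof.
move=> [h1 h2] [k1 k2].
have e2 : y2 = y1 + s * (x2 - x1) by rewrite -h1; ring.
have eb : b = s * (y1 + y2)
    - (x1 ^+ 2 + x1 * x2 + x2 ^+ 2 + a * (x1 + x2)) by rewrite h2; ring.
set p := third_x _ _ _ in k1 k2 *; set q := third_y _ _ _ _ in k1 k2 *.
have -> : (s + t) * (y3 - (s * (x3 - x1) + y1)) =
    t * (q + y3) + s * (y3 - q - t * (x3 - p))
    - s * (s * (x3 - x1) + y1) + s * q
    + t * (s * (x3 - p) - q - (s * (x3 - x1) + y1)) by ring.
by rewrite k1 k2 eb e2 /q /third_y /p /third_x; ring.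
Qed.

(** When x(B) and x(C) differ, x(C) - x(B) cancels in [slope_add]; when B = C, the tangent condition
    on [u] takes its place. *)
Lemma slope_add_diff {x1 y1 x2 y2 x3 y3 s t u} :
  2%:R != 0 :> K ->
  slope x1 y1 x2 y2 s ->
  slope (third_x s x1 x2) (third_y s x1 y1 x2) x3 y3 t ->
  slope x2 y2 x3 y3 u -> ~ (x2 = x3 /\ y2 = - y3) ->
  (s + t) * (u - s) = x3 - x1.
Proof.
move=> c2 h k l ne; have w := slope_add h k.
move: h k l => [h1 h2] [k1 k2] [l1 l2].
have e2 : y2 = y1 + s * (x2 - x1) by rewrite -h1; ring.
case: (eqVneq x2 x3) => [e|ne'].
  subst x3; have e3 : y3 = y2 by apply/eqP; rewrite -subr_eq0 l1 subrr mulr0.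
  subst y3; have y0 : y2 != 0.
    by apply/eqP => y0; apply: ne; rewrite y0 oppr0.
  apply: (@mulIf _ (2%:R * y2)); first by rewrite mulf_neq0.
  (* -(A + B) lies on the line of slope [s] through B, and slope [t] joins A + B to B = C. *)
  have E : (s + t) * (x2 - third_x s x1 x2) = 2%:R * y2.
    by rewrite mulrDl -k1 e2 /third_y; ring.
  have -> : (s + t) * (u - s) * (2%:R * y2) =
    (s + t) * (u * (y2 + y2) - 2%:R * s * y2) by ring.
  rewrite l2 -E mulrA [(x2 - x1) * _]mulrC -!mulrA; congr (_ * _).
  have eb : b = s * (y1 + y2)
    - (x1 ^+ 2 + x1 * x2 + x2 ^+ 2 + a * (x1 + x2)) by rewrite h2; ring.
  by rewrite eb e2 /third_x; ring.
apply: (@mulIf _ (x3 - x2)); first by rewrite subr_eq0 eq_sym.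
rewrite -w -mulrA; congr (_ * _); rewrite mulrBl -l1 e2; ring.
Qed.

Lemma third_assoc {x1 y1 x2 y2 x3 y3 s t u v} :
  2%:R != 0 :> K ->
  slope x1 y1 x2 y2 s -> slope x2 y2 x3 y3 u ->
  ~ (x1 = x2 /\ y1 = - y2) -> ~ (x2 = x3 /\ y2 = - y3) ->
  ~ (x1 = x3 /\ y1 = y3) ->
  slope (third_x s x1 x2) (third_y s x1 y1 x2) x3 y3 t ->
  slope x1 y1 (third_x u x2 x3) (third_y u x2 y2 x3) v ->
  third_x t (third_x s x1 x2) x3 = third_x v x1 (third_x u x2 x3) /\
  third_y t (third_x s x1 x2) (third_y s x1 y1 x2) x3
    = third_y v x1 y1 (third_x u x2 x3).
Proof.
move=> c2 h k ne12 ne23 ne13 l m.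
have w1 := slope_add_diff c2 h l k ne23.
have sw : third_x u x3 x2 = third_x u x2 x3 by rewrite /third_x; ring.
have sy : third_y u x3 y3 x2 = third_y u x2 y2 x3.
  have [k1 _] := k; have -> : y3 = y2 + u * (x3 - x2) by rewrite -k1; ring.
  by rewrite /third_y /third_x; ring.
(* The same relation with A and C exchanged. *)
have w2 : (u + v) * (s - u) = x1 - x3.
  apply: (slope_add_diff c2 (slope_sym k) _ (slope_sym h)).
    by rewrite sw sy; apply: slope_sym.
  by move=> [e e']; apply: ne12; rewrite e e' opprK.
have [h1 _] := h; have [k1 _] := k.
have e1 : y1 = y2 - s * (x2 - x1) by rewrite -h1; ring.
have e3 : y3 = y2 + u * (x3 - x2) by rewrite -k1; ring.
(* If [u = s], then x(A) = x(C) by [w1]; both points lie on one non-vertical line through B, so they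
   coincide. *)
have us : u - s != 0.
  apply/eqP => e; apply: ne13.
  have e' : x3 = x1 by apply/eqP; rewrite -subr_eq0 -w1 e mulr0.
  move/eqP: e; rewrite subr_eq0 => /eqP e.
  by split=> //; rewrite e1 e3 e e'; ring.
have w12 : s + t = u + v.
  by apply: (mulIf us); rewrite w1 -[x3 - x1]opprB -w2; ring.
have et : t = u + v - s by rewrite -w12; ring.
have ex1 : x1 = x3 - (u + v) * (u - s) by rewrite -w12 w1; ring.
have [l1 _] := l.
have eq : third_y s x1 y1 x2 = y3 - t * (x3 - third_x s x1 x2).
  by rewrite -l1; ring.
split; first by rewrite /third_x et ex1; ring.
rewrite {1}/third_y eq /third_y /third_x e1 e3 et ex1; ring.
Qed.

End Slope.

Arguments slope {K} a b x1 y1 x2 y2 s.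
Arguments third_x {K} a s x1 x2.
Arguments third_y {K} a s x1 y1 x2.

(** * Partial associativity of the chord-and-tangent law *)

Section Group.
Context {a b c : int}.
Notation slopeE := (slope (a%:~R : rat) b%:~R).
Notation add_x := (third_x (a%:~R : rat)).
Notation add_y := (third_y (a%:~R : rat)).

Lemma ec_addr0 P : ec_add a b P Infinity = P.
Proof. by case: P. Qed.

Lemma ec_add_eq_inf {x1 y1 x2 y2} :
  ec_add a b (Affine x1 y1) (Affine x2 y2) = Infinity <->
  x1 = x2 /\ y1 = - y2.
Proof.
rewrite /=; case: eqP => [-> |ne]; last by split=> // -[].
by case: eqP => [-> |ne]; split=> // -[].
Qed.

Lemma slope_exists {x1 y1 x2 y2} :
  on_cubic a b c x1 y1 -> on_cubic a b c x2 y2 ->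
  ~ (x1 = x2 /\ y1 = - y2) ->
  exists2 s, slopeE x1 y1 x2 y2 s &
    ec_add a b (Affine x1 y1) (Affine x2 y2)
      = Affine (add_x s x1 x2) (add_y s x1 y1 x2).
Proof.
rewrite /on_cubic /= => h1 h2 ne.
case: eqP => [e|/eqP nx].
  subst x2; case: eqP => [e|/eqP ny]; first by case: ne.
  have : (y1 - y2) * (y1 + y2) = 0 by rewrite -subr_sqr h1 h2 subrr.
  move/eqP; rewrite mulf_eq0 subr_eq0 addr_eq0 (negPf ny) orbF => /eqP e.
  subst y2; have y0 : y1 != 0.
    by apply: contra ny => /eqP ->; rewrite oppr0.
  exists ((3%:R * x1 ^+ 2 + 2%:R * a%:~R * x1 + b%:~R) / (2%:R * y1)) => //.
  by split; field.
have d0 : x2 - x1 != 0 by rewrite subr_eq0 eq_sym.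
exists ((y2 - y1) / (x2 - x1)) => //.
split; first by field.
apply: (mulIf d0); rewrite mulrAC divfK // [y1 + y2]addrC -subr_sqr h1 h2.
ring.
Qed.

Lemma ec_add_slope {x1 y1 x2 y2 s} :
  on_cubic a b c x1 y1 -> on_cubic a b c x2 y2 ->
  ~ (x1 = x2 /\ y1 = - y2) -> slopeE x1 y1 x2 y2 s ->
  ec_add a b (Affine x1 y1) (Affine x2 y2)
    = Affine (add_x s x1 x2) (add_y s x1 y1 x2).
Proof.
move=> h1 h2 ne hs; have [t ht ->] := slope_exists h1 h2 ne.
by rewrite (slope_uniq ne hs ht).
Qed.

Lemma ec_addC P Q :
  on_curve a b c P -> on_curve a b c Q -> ec_add a b P Q = ec_add a b Q P.
Proof.
case: P Q => [|x1 y1] [|x2 y2] // h1 h2.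
have [/andP[/eqP e /eqP e']|ne] := boolP ((x1 == x2) && (y1 == - y2)).
  by rewrite (ec_add_eq_inf.2 (conj e e')) ec_add_eq_inf.2 // e e' opprK.
have ne' : ~ (x1 = x2 /\ y1 = - y2).
  by move=> [e e']; case/negP: ne; rewrite e e' !eqxx.
have [s hs ->] := slope_exists h1 h2 ne'.
rewrite (ec_add_slope h2 h1 _ (slope_sym hs)); last first.
  by move=> [e e']; apply: ne'; rewrite e e' opprK.
have [k1 _] := hs; have -> : y2 = y1 + s * (x2 - x1) by rewrite -k1; ring.
by congr Affine; rewrite /third_y /third_x; ring.
Qed.

Lemma ec_addA P Q R :
  on_curve a b c P -> on_curve a b c Q -> on_curve a b c R ->
  ec_add a b P Q <> Infinity -> ec_add a b Q R <> Infinity ->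
  ec_add a b P (ec_add a b Q R) <> Infinity ->
  ec_add a b (ec_add a b P Q) R = ec_add a b P (ec_add a b Q R).
Proof.
move=> hP hQ hR; have hPQ := ec_add_on_curve hP hQ.
have hQR := ec_add_on_curve hQ hR; move: hP hQ hR hPQ hQR.
case: P Q R => [|x1 y1] // [|x2 y2] // [|x3 y3] //.
  by rewrite !ec_addr0.
move=> h1 h2 h3 h12 h23 n12 n23.
have {}n12 : ~ (x1 = x2 /\ y1 = - y2) by move/ec_add_eq_inf.
have {}n23 : ~ (x2 = x3 /\ y2 = - y3) by move/ec_add_eq_inf.
have [s hs es] := slope_exists h1 h2 n12.
have [u hu eu] := slope_exists h2 h3 n23.
rewrite es in h12 *; rewrite eu in h23 * => n1.
have {}n1 : ~ (x1 = add_x u x2 x3 /\ y1 = - add_y u x2 y2 x3).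
  by move/ec_add_eq_inf.
(* If P + Q = -R, then R is the third point on the line through P and Q, so Q + R = -P, against
   [n1]. *)
have n3 : ~ (add_x s x1 x2 = x3 /\ add_y s x1 y1 x2 = - y3).
  move=> [e e']; apply: n1.
  have := slope_third_neg hs; rewrite e e' opprK => hs'.
  have us := slope_uniq n23 hu hs'; subst u.
  rewrite /third_y /third_x -e /third_x.
  have [k1 _] := hs; have -> : y2 = y1 + s * (x2 - x1) by rewrite -k1; ring.
  by split; ring.
(* The case P = R, excluded from [third_assoc], follows from commutativity. *)
have [/andP[/eqP e /eqP e']|ne13] := boolP ((x1 == x3) && (y1 == y3)).
  rewrite -e -e' in eu h23 *; rewrite -es -eu (ec_addC _ _ h1 h2).
  by apply: ec_addC; rewrite // eu.
have {}ne13 : ~ (x1 = x3 /\ y1 = y3).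
  by move=> [e e']; case/negP: ne13; rewrite e e' !eqxx.
have [t ht ->] := slope_exists h12 h3 n3.
have [v hv ->] := slope_exists h1 h23 n1.
have [] := third_assoc _ hs hu n12 n23 ne13 ht hv => // -> ->.
by [].
Qed.

Lemma ec_mul_on_curve i {P} : on_curve a b c P -> on_curve a b c (ec_mul a b i P).
Proof. by move=> hP; elim: i => [|i IH] //; exact: ec_add_on_curve. Qed.

(** Infinite order keeps all positive multiples of P affine, so [ec_addA] applies to them; zero
    multiples are split off first. *)
Lemma ec_mulD P i j :
  on_curve a b c P -> infinite_order a b P ->
  ec_mul a b (i + j) P = ec_add a b (ec_mul a b i P) (ec_mul a b j P).
Proof.
move=> hP oP; elim: i => [//|i IH].
case: j IH => [|j] IH; first by rewrite addn0 ec_addr0.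
case: i IH => [|i] IH; first by rewrite [ec_mul a b 1 P]ec_addr0.
have hm k := ec_mul_on_curve k hP.
rewrite [in RHS]/ec_mul [in RHS]iterS -!/(ec_mul _ _ _ _).
rewrite ec_addA //; first by rewrite -IH.
- exact: (oP i.+2).
- by rewrite -IH; apply: oP; rewrite addSn.
- by rewrite -IH; apply: (oP (i.+1 + j.+1).+1).
Qed.

End Group.

(** * Denominators under duplication *)

Lemma ec_double_denominator {a b c : int} {Q : point} {m n e m' n' e' : int} :
  on_curve a b c Q -> lowest_terms Q m n e ->
  lowest_terms (ec_add a b Q Q) m' n' e' ->
  exists2 F : int, e' = F * e & (F %| 2 * n)%Z.
Proof.
move=> hQ [eQ e1 cme cne] [eQQ e1' cme' cne']; subst Q.
have e0 : e != 0 by rewrite gt_eqF // (lt_le_trans _ e1).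
have e0' : e' != 0 by rewrite gt_eqF // (lt_le_trans _ e1').
have E0 : e%:~R != 0 :> rat by rewrite intr_eq0.
have E0' : e'%:~R != 0 :> rat by rewrite intr_eq0.
(* This is x^4 - 2bx^2 - 8cx + b^2 - 4ac, the numerator of the duplication formula, at x = m/e^2 and
   scaled by e^8. Splitting off m^4 shows that it is prime to e. *)
pose M := m ^+ 4 + e * (- 2 * b * m ^+ 2 * e ^+ 3 - 8 * c * m * e ^+ 5
  + (b ^+ 2 - 4 * a * c) * e ^+ 7).
have key : 4 * n ^+ 2 * e ^+ 2 * m' = M * e' ^+ 2.
  have cE : c%:~R = (n%:~R ^+ 2 - m%:~R ^+ 3 - a%:~R * m%:~R ^+ 2 * e%:~R ^+ 2
      - b%:~R * m%:~R * e%:~R ^+ 4) / e%:~R ^+ 6 :> rat.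
    have -> : n%:~R ^+ 2 = (n%:~R / e%:~R ^+ 3) ^+ 2 * e%:~R ^+ 6 :> rat by field.
    by rewrite hQ; field.
  move: eQQ; rewrite /= eqxx; case: eqP => // /eqP ny [ex _].
  have n0 : n%:~R != 0 :> rat.
    by apply: contra ny => /eqP ->; rewrite mul0r oppr0.
  have mE : m'%:~R = m'%:~R / e'%:~R ^+ 2 * e'%:~R ^+ 2 :> rat by field.
  apply/eqP; rewrite -(eqr_int rat); apply/eqP.
  rewrite /M !(rmorphM, rmorphD, rmorphB, rmorphN, rmorphXn) /= mE -ex cE.
  by field; rewrite n0 E0.
have cMe : coprimez e M.
  rewrite /M addrC [e * _]mulrC /coprimez gcdzMDl -/(coprimez _ _).
  by rewrite coprimezXr // coprimez_sym.
(* By [key], e^2 divides M e'^2, and e is prime to M. *)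
have /dvdzP[F eF] : (e %| e')%Z.
  rewrite dvdzE -(@dvdn_pexp2r _ _ 2) // -!abszX -dvdzE.
  rewrite -(@Gauss_dvdzr _ M) ?coprimezXl // -key.
  by rewrite dvdz_mulr // dvdz_mull.
exists F => //.
(* By [key], e'^2 divides (2ne)^2 m', and e' is prime to m'. *)
have : (e' ^+ 2 %| (2 * n * e) ^+ 2)%Z.
  rewrite -(@Gauss_dvdzl _ _ m'); last by rewrite coprimezXl // coprimez_sym.
  have -> : (2 * n * e) ^+ 2 * m' = 4 * n ^+ 2 * e ^+ 2 * m' by ring.
  by rewrite key dvdz_mull.
rewrite dvdzE !abszX dvdn_pexp2r // -dvdzE eF.
by rewrite dvdz_mul2r.
Qed.

(** * Common divisors of elliptic Fermat numbers *)

Theorem theorem1p3 (a b c : int) (P : point) (m n e : nat -> int)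
    (k l : nat) :
  is_elliptic_curve a b c ->
  on_curve a b c P ->
  infinite_order a b P ->
  (forall i : nat, lowest_terms (ec_mul a b (2 ^ i) P) (m i) (n i) (e i)) ->
  k <> l ->
  exists Fk Fl : int,
    [/\ ec_fermat e k = Fk%:~R, ec_fermat e l = Fl%:~R
      & gcdz Fk Fl = 1 \/ gcdz Fk Fl = 2].
Proof.
move=> _ hP oP he kl.
have step i : exists2 F : int, e i.+1 = F * e i & (F %| 2 * n i)%Z.
  apply: (ec_double_denominator (ec_mul_on_curve (2 ^ i) hP) (he i)).
  by rewrite -(ec_mulD _ _ _ hP oP) addnn -mul2n -expnS.
have e_neq0 i : e i != 0.
  by have [_ e1 _ _] := he i; rewrite gt_eqF // (lt_le_trans _ e1).
have fermat_int i : exists2 F : int,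
    ec_fermat e i = F%:~R & forall j, (i <= j)%N -> (F %| e j)%Z.
  have e_dvd j j' : (j <= j')%N -> (e j %| e j')%Z.
    move/subnK <-; elim: (j' - j)%N => [|d IH]; first exact: dvdzz.
    by have [F eF _] := step (d + j)%N; rewrite addSn eF dvdz_mull.
  case: i => [|i]; first by exists (e 0%N) => // j _; apply: e_dvd.
  have [F eF _] := step i; exists F => [|j ij].
    by rewrite /= eF rmorphM /= mulfK // intr_eq0.
  by apply: dvdz_trans (e_dvd _ _ ij); rewrite eF dvdz_mulr.
have gcd_lt i j (F G : int) : (i < j)%N ->
    ec_fermat e i = F%:~R -> ec_fermat e j = G%:~R ->
    gcdz F G = 1 \/ gcdz F G = 2.
  case: j => // j; rewrite ltnS => ij eF eG.
  have [F' eF' dF'] := fermat_int i.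
  have FF' : F = F' by apply/eqP; rewrite -(eqr_int rat) -eF eF'.
  have [G' eG' dG'] := step j.
  have GG' : G = G'.
    by apply/eqP; rewrite -(eqr_int rat) -eG /= eG' rmorphM /= mulfK // intr_eq0.
  subst F' G'.
  have [_ _ _ cne] := he j.
  (* The larger index is now [j.+1], so [F] divides [e j], which is prime to [n j], while [G]
     divides [2 * n j]. *)
  have : (gcdz F G %| 2)%Z.
    rewrite -(@Gauss_dvdzl _ _ (n j)).
      exact: dvdz_trans (dvdz_gcdr _ _) dG'.
    apply: coprimez_dvdl (dvdz_trans (dvdz_gcdl F G) (dF' _ ij)) _.
    by rewrite coprimez_sym.
  rewrite /gcdz dvdzE /=; move: (gcdn _ _) => d dd.
  have := dvdn_leq (isT : (0 < 2)%N) dd; case: d dd => [|[|[|d]]] //; first by left.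
  by right.
have [Fk ek _] := fermat_int k; have [Fl el _] := fermat_int l.
exists Fk, Fl; split=> //.
have [lt|lt|//] := ltngtP k l; first exact: gcd_lt lt ek el.
by rewrite gcdzC; apply: gcd_lt lt el ek.
Qed.
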